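(* Let $R>0$, $m\in\mathbb{Z}$, and let $f:[0,\infty)\to\mathbb{R}$ be a bounded function, with $f_{\max}=\sup\{|f(I)|: I\in[0,\infty)\}<\infty$. Let $(A,\lambda)$ be a nontrivial finite energy solution pair of the two-point boundary value problem $$\frac{d^2A}{dr^2}+\frac1r\frac{dA}{dr}-\frac{m^2}{r^2}A-\lambda A+f(A^2)A=0,\quad r\in(0,R),\qquad A(0)=0=A(R).$$ Then $$\lambda\le f_{\max}-\frac{r_0^2+m^2}{R^2},$$ where $r_0\ (\approx 2.404825)$ is the first positive zero of the Bessel function $J_0$.
   Context: A solution pair $(A,\lambda)$ consists of a real number $\lambda$ (the nonlinear frequency shift) and a real-valued function $A$, continuous on $[0,R]$ and twice differentiable on $(0,R)$, satisfying the differential equation on $(0,R)$ and the boundary conditions. It is nontrivial if $A\not\equiv 0$. It has finite energy if $$\mathcal{E}(A)=\int_0^R\left\{rA_r^2+\frac{A^2}{r}\right\}dr<\infty,$$ where $A_r=dA/dr$. *)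

(* Defs.v *)
From Stdlib Require Export Reals Factorial.
From Coquelicot Require Export Coquelicot.

Open Scope R_scope.

(** The power series of J_0, sum_k (-1)^k / (k!)^2 * (x/2)^(2k), seen as a
    power series in (x/2)^2. *)
Definition bessel_J0 (x : R) : R :=
  PSeries (fun k => (-1) ^ k / INR (fact k) ^ 2) ((x / 2) ^ 2).

Definition is_first_positive_zero (g : R -> R) (z : R) : Prop :=
  0 < z /\ g z = 0 /\ forall x, 0 < x < z -> g x <> 0.

(** Only the values of [f] on [0, +oo) matter here and below: the
    nonlinearity is evaluated at [A r ^ 2] only. *)
Definition abs_range (f : R -> R) (y : R) : Prop :=
  exists I, 0 <= I /\ y = Rabs (f I).

Definition f_max (f : R -> R) : R := real (Lub_Rbar (abs_range f)).

(** [Rad] is the radius of the disc.  [Derive] is total, so differentiability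
    of [A] and of its derivative is required explicitly. *)
Record solution_pair (Rad : R) (m : Z) (f A : R -> R) (lambda : R) : Prop := {
  sol_continuous : continuous_on (fun r => 0 <= r <= Rad) A;
  sol_derivable : forall r, 0 < r < Rad -> ex_derive A r;
  sol_derivable2 : forall r, 0 < r < Rad -> ex_derive (Derive A) r;
  sol_ode : forall r, 0 < r < Rad ->
    Derive_n A 2 r + 1 / r * Derive A r - IZR m ^ 2 / r ^ 2 * A r
      - lambda * A r + f (A r ^ 2) * A r = 0;
  sol_left : A 0 = 0;
  sol_right : A Rad = 0
}.

Definition nontrivial_on (Rad : R) (A : R -> R) : Prop :=
  exists r, 0 <= r <= Rad /\ A r <> 0.

(** The energy density is continuous and nonnegative on (0, Rad), possibly
    unbounded at both ends: the energy is finite when the integral, improper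
    at both ends, converges. *)
Definition finite_energy (Rad : R) (A : R -> R) : Prop :=
  ex_RInt_gen (fun r => r * Derive A r ^ 2 + A r ^ 2 / r)
    (at_right 0) (at_left Rad).

(* Main.v *)
Require Import Defs.
From Stdlib Require Import Lra Lia.

(** The inequality is a Sturm comparison between [A] and the Bessel profile
    [J r = J_0 (r0 r / Rad)], which is positive on [0, Rad).  Suppose that it
    fails.  In self-adjoint form the two equations read
    [(r A')' = r q A], with [q = m^2/r^2 + lambda - f (A^2)], and
    [(r J')' = - k r J], with [k = (r0/Rad)^2].  As [r <= Rad] and
    [|f| <= f_max], the assumption gives [q >= - k] on (0, Rad), so that the Picone
    Wronskian [w = r (A' J - A J')], whose derivative is [r (q + k) A J], is
    nondecreasing wherever [A >= 0].

    If [A] took a positive value, it would have to grow after its last earlier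
    zero, hence [A] and [A'] would be positive at some point [xi]; since
    [J' <= 0] there, also [w xi > 0] ([crossing_point]).  Let [b] be the next
    zero of [A], which exists because [A Rad = 0].  On [xi, b) we have
    [w >= w xi > 0], while [r A J'] tends to 0 at [b]; so [A' > 0] just before
    [b], and the positive function [A] increases to the value 0: a
    contradiction ([comparison_nonpos]).  The same applies to [- A], whence
    [A = 0] on [0, Rad].  Only the sign of [A'] near a zero enters; this is
    what lets the argument reach the singular point 0 and the end point [Rad],
    and cover an [f] that is merely bounded. *)

(** * Continuous real functions on an interval *)

(** The intermediate point has to lie in the open interval, where alone the
    derivative is known; Cauchy's form of the theorem provides this. *)
Lemma mean_value_open (g dg : R -> R) (a b : R) :
  a < b ->
  (forall x, a < x < b -> is_derive g x (dg x)) ->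
  (forall x, continuity_pt g x) ->
  exists c, a < c < b /\ g b - g a = dg c * (b - a).
Proof.
intros ab Hd Hc.
assert (pr : forall x, a < x < b -> derivable_pt g x).
{ intros x Hx. exists (dg x). apply is_derive_Reals, Hd, Hx. }
destruct (MVT g id a b pr (fun x _ => derivable_pt_id x)) as [c [P E]].
- exact ab.
- intros; apply Hc.
- intros; apply derivable_continuous_pt, derivable_pt_id.
- exists c; split; [exact P|].
  rewrite (derive_pt_eq_0 g c (dg c)) in E
    by (apply is_derive_Reals, Hd, P).
  rewrite (derive_pt_eq_0 id c 1) in E by apply derivable_pt_lim_id.
  unfold id in E; lra.
Qed.

Lemma continuity_pt_pos (g : R -> R) (x : R) :
  continuity_pt g x -> 0 < g x ->
  exists d, 0 < d /\ forall y, Rabs (y - x) < d -> 0 < g y.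
Proof.
intros Hc Hp.
apply continuity_pt_filterlim in Hc.
destruct (Hc (fun z => 0 < z)) as [d Hd].
- exists (mkposreal _ Hp); intros y Hy.
  apply Rabs_def2 in Hy; cbn in Hy; unfold minus, plus, opp in Hy; cbn in Hy.
  lra.
- exists d; split; [apply cond_pos|]. intros y Hy; apply Hd, Hy.
Qed.

Lemma first_zero (g : R -> R) (a b : R) :
  (forall x, continuity_pt g x) -> a <= b -> 0 < g a -> g b = 0 ->
  exists c, a < c <= b /\ g c = 0 /\ forall x, a <= x < c -> 0 < g x.
Proof.
intros Hc ab Ha Hb.
set (E := fun x => a <= x <= b /\ forall y, a <= y <= x -> 0 < g y).
destruct (completeness E) as [c [Hub Hleast]].
- exists b; intros x [Hx _]; lra.
- exists a; split; [lra|]. intros y Hy; replace y with a by lra; exact Ha.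
- assert (Ea : E a).
  { split; [lra|]. intros y Hy; replace y with a by lra; exact Ha. }
  assert (ac := Hub a Ea).
  assert (cb : c <= b) by (apply Hleast; intros x [Hx _]; lra).
  assert (below : forall x, a <= x < c -> 0 < g x).
  { intros x Hx. apply Rnot_le_lt; intros Hn.
    (* a point where [g] is not positive bounds [E] from above *)
    enough (c <= x) by lra.
    apply Hleast; intros z [Hz Pz].
    apply Rnot_lt_le; intros xz. specialize (Pz x); lra. }
  assert (gc : g c = 0).
  { destruct (Rtotal_order (g c) 0) as [Hn | [H0 | Hp]]; [|exact H0|].
    - exfalso.
      destruct (continuity_pt_pos (fun x => - g x) c) as [d [d0 Hd]].
      + apply continuity_pt_opp, Hc.
      + lra.
      + assert (a < c) by (destruct ac as [? | E0]; [lra | subst c; lra]).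
        assert (M := Rmax_l a (c - d / 2)). assert (N := Rmax_r a (c - d / 2)).
        assert (Rmax a (c - d / 2) < c) by (apply Rmax_lub_lt; lra).
        specialize (below (Rmax a (c - d / 2))).
        specialize (Hd (Rmax a (c - d / 2))).
        assert (Rabs (Rmax a (c - d / 2) - c) < d) by (apply Rabs_def1; lra).
        specialize (Hd H1); specialize (below (conj M H0)); lra.
    - exfalso.
      destruct (continuity_pt_pos g c (Hc c) Hp) as [d [d0 Hd]].
      assert (c < b) by (destruct cb as [? | E0]; [lra | subst c; lra]).
      set (z := Rmin b (c + d / 2)).
      assert (z <= b) by apply Rmin_l. assert (z <= c + d / 2) by apply Rmin_r.
      assert (c < z) by (apply Rmin_glb_lt; lra).
      enough (z <= c) by lra.
      apply Hub; split; [lra|]. intros y Hy.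
      destruct (Rlt_le_dec y c); [apply below; lra|].
      apply Hd, Rabs_def1; lra. }
  exists c; repeat split; auto.
  destruct ac as [? | E0]; [auto | subst c; lra].
Qed.

Lemma last_zero (g : R -> R) (a b : R) :
  (forall x, continuity_pt g x) -> a <= b -> g a = 0 -> 0 < g b ->
  exists c, a <= c < b /\ g c = 0 /\ forall x, c < x <= b -> 0 < g x.
Proof.
intros Hc ab Ha Hb.
destruct (first_zero (fun x => g (- x)) (- b) (- a)) as [c [Hc1 [Hc2 Hc3]]].
- intros x. apply (continuity_pt_comp Ropp g).
  + apply continuity_pt_opp, continuity_pt_id.
  + apply Hc.
- lra.
- now rewrite Ropp_involutive.
- now rewrite Ropp_involutive.
- exists (- c); repeat split; try lra.
  intros x Hx. replace x with (- - x) by ring. apply Hc3; lra.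
Qed.

(** Continuity relative to a compact interval is continuity of the extension
    by constants; with it the boundary points need no one-sided limits. *)
Definition clamp (a b x : R) : R := Rmax a (Rmin x b).

Lemma clamp_in (a b x : R) : a <= b -> a <= clamp a b x <= b.
Proof.
intros ab; split; [apply Rmax_l|].
apply Rmax_lub; [exact ab | apply Rmin_r].
Qed.

Lemma clamp_id (a b x : R) : a <= x <= b -> clamp a b x = x.
Proof. intros; unfold clamp; rewrite Rmin_left, Rmax_right; lra. Qed.

Lemma clamp_lipschitz (a b x y : R) :
  Rabs (clamp a b y - clamp a b x) <= Rabs (y - x).
Proof.
unfold clamp, Rmax, Rmin.
repeat (destruct Rle_dec); unfold Rabs; repeat destruct Rcase_abs; lra.
Qed.

Lemma continuity_clamp (a b : R) (g : R -> R) :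
  a <= b -> continuous_on (fun r => a <= r <= b) g ->
  forall x, continuity_pt (fun r => g (clamp a b r)) x.
Proof.
intros ab Hg x. apply continuity_pt_filterlim.
intros P HP.
destruct (Hg (clamp a b x) (clamp_in a b x ab) P HP) as [d Hd].
exists d; intros y Hy.
apply (Hd (clamp a b y)); [|apply clamp_in, ab].
apply (Rle_lt_trans _ _ _ (clamp_lipschitz a b x y) Hy).
Qed.

(** * Sturm comparison for radial equations *)

Lemma crossing_point (Rad : R) (u v : R -> R) (r1 : R) :
  (forall x, continuity_pt u x) -> u 0 = 0 ->
  (forall r, 0 < r < Rad -> is_derive u r (v r / r)) ->
  0 < r1 < Rad -> 0 < u r1 ->
  exists xi, 0 < xi < Rad /\ 0 < u xi /\ 0 < v xi.
Proof.
intros Hc u0 Hu Hr1 Hp.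
destruct (last_zero u 0 r1) as [a [Ha [ua Hpos]]]; auto; try lra.
destruct (mean_value_open u (fun r => v r / r) a r1) as [xi [Hxi E]];
  auto; try lra.
{ intros; apply Hu; lra. }
exists xi; split; [lra|]; split; [apply Hpos; lra|].
rewrite ua in E.
assert (Q : 0 < v xi / xi).
{ apply Rnot_le_lt; intros Hn.
  assert (v xi / xi * (r1 - a) <= 0); [|lra].
  assert (0 <= (- (v xi / xi)) * (r1 - a)) by (apply Rmult_le_pos; lra). lra. }
replace (v xi) with (v xi / xi * xi) by (field; lra).
apply Rmult_lt_0_compat; lra.
Qed.

(** [v] and [K] stand for [r u'] and [r J'].  [K] has to be continuous up to
    [Rad], for this makes [u K] vanish at the zeros of [u], including the zero
    at [Rad]; [J] itself is allowed to vanish there. *)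
Lemma comparison_nonpos (Rad k : R) (q u v J K : R -> R) :
  (forall x, continuity_pt u x) -> u 0 = 0 -> u Rad = 0 ->
  (forall r, 0 < r < Rad -> is_derive u r (v r / r)) ->
  (forall r, 0 < r < Rad -> is_derive v r (r * q r * u r)) ->
  (forall r, 0 < r < Rad -> is_derive J r (K r / r)) ->
  (forall r, 0 < r < Rad -> is_derive K r (- (k * r * J r))) ->
  (forall r, 0 < r < Rad -> 0 < J r) ->
  (forall r, 0 < r < Rad -> K r <= 0) ->
  (forall x, continuity_pt K x) ->
  (forall r, 0 < r < Rad -> - k <= q r) ->
  forall r, 0 < r < Rad -> u r <= 0.
Proof.
intros Hc u0 uR Hu Hv HJ HK Jpos Kneg Kc Hq r1 Hr1.
apply Rnot_lt_le; intros Hp.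
destruct (crossing_point Rad u v r1) as [xi [Hxi [uxi vxi]]]; auto.
destruct (first_zero u xi Rad) as [b [Hb [ub Hpos]]]; auto; try lra.
set (w := fun r => v r * J r - u r * K r).
assert (Dw : forall r, 0 < r < Rad ->
  is_derive w r (r * (q r + k) * u r * J r)).
{ intros r Hr.
  assert (E : r * (q r + k) * u r * J r =
    (r * q r * u r * J r + v r * (K r / r))
    - (v r / r * K r + u r * (- (k * r * J r)))) by (field; lra).
  rewrite E. apply @is_derive_minus.
  - apply (is_derive_mult v J); auto. exact Rmult_comm.
  - apply (is_derive_mult u K); auto. exact Rmult_comm. }
assert (wxi : 0 < w xi).
{ unfold w.
  assert (0 < v xi * J xi) by (apply Rmult_lt_0_compat; auto).
  assert (0 <= u xi * - K xi)
    by (apply Rmult_le_pos; [lra | specialize (Kneg xi Hxi); lra]).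
  lra. }
assert (wmono : forall r, xi < r < b -> w xi <= w r).
{ intros r Hr.
  destruct (MVT_gen w xi r (fun r => r * (q r + k) * u r * J r))
    as [c [Hcc E]]; rewrite ?Rmin_left, ?Rmax_right in * by lra.
  - intros x Hx; apply Dw; lra.
  - intros x Hx. apply continuity_pt_filterlim.
    apply @ex_derive_continuous. eexists; apply Dw; lra.
  - assert (Hcr : 0 < c < Rad) by lra.
    assert (P : 0 <= c * (q c + k) * u c * J c).
    { specialize (Hq c Hcr). specialize (Jpos c Hcr).
      assert (0 < u c) by (apply Hpos; lra).
      repeat apply Rmult_le_pos; lra. }
    assert (0 <= c * (q c + k) * u c * J c * (r - xi))
      by (apply Rmult_le_pos; lra).
    lra. }
(* [u K] vanishes at [b], so it is dominated by [w xi] near [b] *)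
destruct (continuity_pt_pos (fun r => w xi + u r * K r) b) as [d [d0 Hd]].
{ apply continuity_pt_plus.
  - apply continuity_pt_const; intros x y; reflexivity.
  - apply (continuity_pt_mult u K); auto. }
{ rewrite ub; lra. }
set (r2 := Rmax xi (b - d / 2)).
assert (xi <= r2) by apply Rmax_l. assert (b - d / 2 <= r2) by apply Rmax_r.
assert (r2 < b) by (apply Rmax_lub_lt; lra).
destruct (mean_value_open u (fun r => v r / r) r2 b) as [c [Hcc E]]; auto.
{ intros; apply Hu; lra. }
assert (vc : 0 < v c).
{ assert (D : 0 < w xi + u c * K c) by (apply Hd, Rabs_def1; lra).
  assert (M := wmono c ltac:(lra)). unfold w in M at 2.
  assert (Jc := Jpos c ltac:(lra)).
  apply (Rmult_lt_reg_r (J c)); [exact Jc | lra]. }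
assert (0 < v c / c * (b - r2)).
{ apply Rmult_lt_0_compat; [apply Rdiv_lt_0_compat|]; lra. }
assert (0 < u r2) by (apply Hpos; lra).
lra.
Qed.

(** * The Bessel profile *)

Definition bessel_coef (k : nat) : R := (-1) ^ k / INR (fact k) ^ 2.

(** [J_0 (2 sqrt t)] for [t >= 0]. *)
Definition bessel_series : R -> R := PSeries bessel_coef.

(** The function [t P' t] for [P] the series above: it plays the role of
    [r J'], up to a factor 2. *)
Definition bessel_flux : R -> R := PSeries (PS_incr_1 (PS_derive bessel_coef)).

Lemma bessel_coef_S (k : nat) :
  INR (S k) ^ 2 * bessel_coef (S k) = - bessel_coef k.
Proof.
unfold bessel_coef. rewrite fact_simpl, mult_INR, <- (tech_pow_Rmult (-1)).
field; split; [apply INR_fact_neq_0 | apply not_0_INR; lia].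
Qed.

Lemma bessel_coef_neq_0 (k : nat) : bessel_coef k <> 0.
Proof.
unfold bessel_coef, Rdiv. apply Rmult_integral_contrapositive_currified.
- apply pow_nonzero; lra.
- apply Rinv_neq_0_compat, pow_nonzero, INR_fact_neq_0.
Qed.

Lemma bessel_CV_radius : CV_radius bessel_coef = p_infty.
Proof.
apply CV_radius_infinite_DAlembert; [apply bessel_coef_neq_0|].
apply is_lim_seq_le_le with (fun _ => 0) (fun k => / INR (S k)).
- intros k; split; [apply Rabs_pos|].
  assert (Hk : 1 <= INR (S k)) by (apply (le_INR 1); lia).
  replace (bessel_coef (S k) / bessel_coef k) with (- / INR (S k) ^ 2).
  + rewrite Rabs_Ropp, Rabs_right.
    * apply Rinv_le_contravar; nra.
    * apply Rle_ge, Rlt_le, Rinv_0_lt_compat; nra.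
  + assert (N := bessel_coef_neq_0 k). assert (S' := bessel_coef_S k).
    replace (bessel_coef k) with (- (INR (S k) ^ 2 * bessel_coef (S k))) by lra.
    field; split; [apply bessel_coef_neq_0 | lra].
- apply is_lim_seq_const.
- apply is_lim_seq_incr_1 with (u := fun k => / INR k).
  apply (is_lim_seq_inv INR p_infty); [apply is_lim_seq_INR | easy].
Qed.

Lemma bessel_flux_eq (t : R) :
  bessel_flux t = t * PSeries (PS_derive bessel_coef) t.
Proof. apply PSeries_incr_1. Qed.

Lemma is_derive_bessel_series (t : R) :
  is_derive bessel_series t (PSeries (PS_derive bessel_coef) t).
Proof. apply is_derive_PSeries. now rewrite bessel_CV_radius. Qed.

(** Bessel's equation [(t P')' = - P] is the recurrence [bessel_coef_S] read
    coefficientwise. *)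
Lemma is_derive_bessel_flux (t : R) :
  is_derive bessel_flux t (- bessel_series t).
Proof.
unfold bessel_series. rewrite <- PSeries_opp.
rewrite (PSeries_ext _ (PS_derive (PS_incr_1 (PS_derive bessel_coef)))).
- apply is_derive_PSeries.
  now rewrite CV_radius_incr_1, CV_radius_derive, bessel_CV_radius.
- intros k. unfold PS_derive, PS_incr_1, PS_opp, opp; cbn -[INR].
  rewrite <- (bessel_coef_S k). ring.
Qed.

Lemma continuity_bessel_series : continuity bessel_series.
Proof.
intros t. apply continuity_pt_filterlim, @ex_derive_continuous.
eexists; apply is_derive_bessel_series.
Qed.

Lemma continuity_bessel_flux : continuity bessel_flux.
Proof.
intros t. apply continuity_pt_filterlim, @ex_derive_continuous.
eexists; apply is_derive_bessel_flux.
Qed.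

Lemma bessel_J0_series (x : R) : bessel_J0 x = bessel_series ((x / 2) ^ 2).
Proof. reflexivity. Qed.

Lemma bessel_J0_pos (r0 x : R) :
  is_first_positive_zero bessel_J0 r0 -> 0 <= x < r0 -> 0 < bessel_J0 x.
Proof.
intros [_ [_ Hz]] Hx.
assert (J00 : bessel_J0 0 = 1).
{ rewrite bessel_J0_series. replace ((0 / 2) ^ 2) with 0 by field.
  unfold bessel_series. rewrite PSeries_0. unfold bessel_coef; cbn; field. }
assert (Hc : continuity bessel_J0).
{ intros y.
  apply (continuity_pt_comp (fun y => (y / 2) ^ 2) bessel_series).
  - apply continuity_pt_filterlim, @ex_derive_continuous. auto_derive. easy.
  - apply continuity_bessel_series. }
apply Rnot_le_lt; intros Hn.
destruct (IVT_gen bessel_J0 0 x 0 Hc) as [y [Hy Ey]].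
- rewrite J00, Rmin_right, Rmax_left; lra.
- rewrite Rmin_left, Rmax_right in Hy by lra.
  apply (Hz y); [|exact Ey].
  assert (y <> 0) by (intros ->; lra). lra.
Qed.

Lemma bessel_flux_nonpos (t : R) :
  0 <= t -> (forall s, 0 <= s < t -> 0 < bessel_series s) -> bessel_flux t <= 0.
Proof.
intros Ht Hp.
assert (F0 : bessel_flux 0 = 0) by (rewrite bessel_flux_eq; ring).
destruct Ht as [Ht | <-]; [|lra].
destruct (mean_value_open bessel_flux (fun s => - bessel_series s) 0 t)
  as [c [Hc E]]; auto.
- intros; apply is_derive_bessel_flux.
- apply continuity_bessel_flux.
- assert (0 < bessel_series c) by (apply Hp; lra).
  assert (0 < bessel_series c * (t - 0)) by (apply Rmult_lt_0_compat; lra).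
  lra.
Qed.

Lemma is_derive_bessel_radial (c r : R) :
  r <> 0 ->
  is_derive (fun s => bessel_series (c * s ^ 2)) r
    (2 * bessel_flux (c * r ^ 2) / r).
Proof.
intros Hr.
replace (2 * bessel_flux (c * r ^ 2) / r)
  with (scal (2 * c * r) (PSeries (PS_derive bessel_coef) (c * r ^ 2))).
- apply (is_derive_comp bessel_series (fun s => c * s ^ 2)).
  + apply is_derive_bessel_series.
  + auto_derive; [easy | ring].
- rewrite bessel_flux_eq. unfold scal; cbn; unfold mult; cbn. field; exact Hr.
Qed.

Lemma is_derive_bessel_radial_flux (c r : R) :
  is_derive (fun s => 2 * bessel_flux (c * s ^ 2)) r
    (- (4 * c * r * bessel_series (c * r ^ 2))).
Proof.
replace (- (4 * c * r * bessel_series (c * r ^ 2)))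
  with (2 * scal (2 * c * r) (- bessel_series (c * r ^ 2)))
  by (unfold scal; cbn; unfold mult; cbn; ring).
apply @is_derive_scal.
apply (is_derive_comp bessel_flux (fun s => c * s ^ 2)).
- apply is_derive_bessel_flux.
- auto_derive; [easy | ring].
Qed.

(** * The bound on the frequency shift *)

Lemma Rabs_le_f_max (f : R -> R) (I : R) :
  bound (abs_range f) -> 0 <= I -> Rabs (f I) <= f_max f.
Proof.
intros [M HM] HI. unfold f_max.
destruct (Lub_Rbar_correct (abs_range f)) as [Hub Hleast].
assert (Hin : abs_range f (Rabs (f I))) by (exists I; auto).
assert (H1 := Hub _ Hin).
assert (H2 := Hleast (Finite M) (fun y Hy => HM y Hy)).
destruct (Lub_Rbar (abs_range f)); cbn in *; easy.
Qed.

Lemma solution_pair_opp (Rad : R) (m : Z) (f A : R -> R) (lambda : R) :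
  solution_pair Rad m f A lambda ->
  solution_pair Rad m f (fun r => - A r) lambda.
Proof.
intros [Hc Hd Hd2 Ho H0 HR].
assert (E : forall r, Derive (fun s => - A s) r = - Derive A r)
  by (intros; apply Derive_opp).
split.
- intros x Hx. apply (filterlim_comp _ _ _ _ _ _ _ _ (Hc x Hx)).
  apply (filterlim_opp (A x)).
- intros r Hr. apply (ex_derive_opp A), Hd, Hr.
- intros r Hr. apply (ex_derive_ext (fun s => - Derive A s)).
  + intros; now rewrite E.
  + apply (ex_derive_opp (Derive A)), Hd2, Hr.
- intros r Hr. rewrite E. specialize (Ho r Hr).
  rewrite (Derive_n_opp A 2 r).
  replace ((- A r) ^ 2) with (A r ^ 2) by ring. lra.
- lra.
- lra.
Qed.

(** Multiplying the equation by [r] absorbs its first-order term into the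
    derivative of [r A'], the form in which the comparison uses it. *)
Lemma solution_pair_flux (Rad : R) (m : Z) (f A : R -> R) (lambda r : R) :
  solution_pair Rad m f A lambda -> 0 < r < Rad ->
  is_derive (fun s => s * Derive A s) r
    (r * (IZR m ^ 2 / r ^ 2 + lambda - f (A r ^ 2)) * A r).
Proof.
intros [Hc Hd Hd2 Ho H0 HR] Hr.
specialize (Ho r Hr).
replace (r * (IZR m ^ 2 / r ^ 2 + lambda - f (A r ^ 2)) * A r)
  with (1 * Derive A r + r * Derive (Derive A) r).
- apply (is_derive_mult (fun s => s) (Derive A)).
  + apply @is_derive_id.
  + apply Derive_correct, Hd2, Hr.
  + exact Rmult_comm.
- change (Derive_n A 2 r) with (Derive (Derive A) r) in Ho.
  apply (Rplus_eq_reg_l (- (r * (IZR m ^ 2 / r ^ 2 + lambda - f (A r ^ 2)) * A r))).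
  rewrite Rplus_opp_l, <- (Rmult_0_r r), <- Ho. field; lra.
Qed.

Lemma solution_nonpos (Rad : R) (m : Z) (f A : R -> R) (lambda r0 : R) :
  0 < Rad ->
  bound (abs_range f) ->
  solution_pair Rad m f A lambda ->
  is_first_positive_zero bessel_J0 r0 ->
  f_max f - (r0 ^ 2 + IZR m ^ 2) / Rad ^ 2 < lambda ->
  forall r, 0 < r < Rad -> A r <= 0.
Proof.
intros HR Hf Hs Hz Hl r Hr.
set (c := (r0 / Rad) ^ 2 / 4).
assert (r0pos : 0 < r0) by apply Hz.
assert (sc : forall s, bessel_series (c * s ^ 2) = bessel_J0 (r0 * s / Rad)).
{ intros s. rewrite bessel_J0_series. f_equal. unfold c; field; lra. }
assert (Jpos : forall s, 0 <= s < Rad -> 0 < bessel_series (c * s ^ 2)).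
{ intros s Hs'. rewrite sc. apply (bessel_J0_pos r0 _ Hz).
  split.
  - apply Rmult_le_pos; [|apply Rlt_le, Rinv_0_lt_compat, HR].
    apply Rmult_le_pos; lra.
  - apply (Rmult_lt_reg_r Rad); [exact HR|].
    replace (r0 * s / Rad * Rad) with (r0 * s) by (field; lra).
    apply Rmult_lt_compat_l; lra. }
assert (cpos : 0 < c).
{ unfold c. assert (0 < r0 / Rad) by (apply Rdiv_lt_0_compat; lra). nra. }
enough (H : A (clamp 0 Rad r) <= 0) by (rewrite clamp_id in H; lra).
apply (comparison_nonpos Rad (4 * c)
  (fun s => IZR m ^ 2 / s ^ 2 + lambda - f (A s ^ 2))
  (fun s => A (clamp 0 Rad s)) (fun s => s * Derive A s)
  (fun s => bessel_series (c * s ^ 2))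
  (fun s => 2 * bessel_flux (c * s ^ 2))); try exact Hr.
- apply continuity_clamp; [lra | apply Hs].
- rewrite clamp_id by lra. apply Hs.
- rewrite clamp_id by lra. apply Hs.
- intros s Hs'. apply (is_derive_ext_loc A).
  + apply (locally_interval _ s (Finite 0) (Finite Rad)); cbn; try lra.
    intros y Hy1 Hy2. rewrite clamp_id; [reflexivity | lra].
  + replace (s * Derive A s / s) with (Derive A s) by (field; lra).
    apply Derive_correct, Hs, Hs'.
- intros s Hs'. rewrite clamp_id by lra.
  apply (solution_pair_flux Rad); assumption.
- intros s Hs'. apply is_derive_bessel_radial; lra.
- intros s _. apply is_derive_bessel_radial_flux.
- intros s Hs'. apply Jpos; lra.
- intros s Hs'. enough (bessel_flux (c * s ^ 2) <= 0) by lra.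
  apply bessel_flux_nonpos; [nra|]. intros t Ht.
  (* every smaller argument is again of the form [c x^2], with [x < s] *)
  assert (t0 : 0 <= t / c)
    by (apply Rmult_le_pos; [lra | apply Rlt_le, Rinv_0_lt_compat, cpos]).
  assert (Et : c * sqrt (t / c) ^ 2 = t)
    by (rewrite pow2_sqrt by exact t0; field; lra).
  rewrite <- Et. apply Jpos; split; [apply sqrt_pos|].
  apply Rnot_le_lt; intros Hn.
  assert (c * s ^ 2 <= c * sqrt (t / c) ^ 2); [|lra].
  apply Rmult_le_compat_l; [lra | apply pow_incr; lra].
- intros s. apply continuity_pt_filterlim.
  apply (ex_derive_continuous (fun s => 2 * bessel_flux (c * s ^ 2)) s).
  eexists; apply (is_derive_bessel_radial_flux c s).
- intros s Hs'.
  assert (F := Rabs_le_f_max f (A s ^ 2) Hf (pow2_ge_0 _)).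
  assert (F' := Rle_abs (f (A s ^ 2))).
  assert (M : IZR m ^ 2 / Rad ^ 2 <= IZR m ^ 2 / s ^ 2).
  { apply Rmult_le_compat_l; [apply pow2_ge_0|].
    apply Rinv_le_contravar; [apply pow_lt; lra | apply pow_incr; lra]. }
  replace (4 * c) with (r0 ^ 2 / Rad ^ 2) by (unfold c; field; lra).
  rewrite Rdiv_plus_distr in Hl. lra.
Qed.

Theorem theorem2p1 (Rad : R) (m : Z) (f A : R -> R) (lambda r0 : R)
  (hRad : 0 < Rad)
  (hf : bound (abs_range f))
  (hsol : solution_pair Rad m f A lambda)
  (hnontriv : nontrivial_on Rad A)
  (henergy : finite_energy Rad A)
  (hr0 : is_first_positive_zero bessel_J0 r0) :
  lambda <= f_max f - (r0 ^ 2 + IZR m ^ 2) / Rad ^ 2.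
Proof.
apply Rnot_lt_le; intros Hl.
destruct hnontriv as [r [Hr HA]].
assert (H0 := sol_left _ _ _ _ _ hsol).
assert (HR := sol_right _ _ _ _ _ hsol).
assert (r <> 0) by (intros ->; auto).
assert (r <> Rad) by (intros ->; auto).
assert (Hr' : 0 < r < Rad) by lra.
assert (P := solution_nonpos _ _ _ _ _ _ hRad hf hsol hr0 Hl r Hr').
assert (N := solution_nonpos _ _ _ _ _ _ hRad hf
  (solution_pair_opp _ _ _ _ _ hsol) hr0 Hl r Hr').
cbv beta in N; lra.
Qed.
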